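(* When the dimension $d$ is a constant, the randomized communication complexity of checking whether a system of linear equations $Ax=b$ is feasible is $O(s\log L)$, in both the coordinator model and the blackboard model.
   Context: There are $s\ge 2$ servers $P_1,\dots,P_s$ and a coordinator. A matrix $A \in \mathbb{R}^{n\times d}$ and vector $b\in\mathbb{R}^n$ with integer entries in $[-2^L,2^L]$ are partitioned row-wise among the servers ($P_i$ holds the equations $A^{(i)}x=b^{(i)}$). In the feasibility testing problem the coordinator must report, upon termination, whether $Ax=b$ has a solution. In the coordinator model each server communicates only with the coordinator via a private two-way channel; in the blackboard model all messages are broadcast on a shared blackboard. Communication complexity is the total number of bits sent; randomized protocols must succeed with constant probability on every input. *)

(* Defs.v *)
From HB Require Import structures.
From mathcomp Require Import all_boot all_order all_algebra.
From mathcomp Require Import all_classical all_reals all_analysis.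

Set Implicit Arguments.
Unset Strict Implicit.
Unset Printing Implicit Defensive.

Import Order.TTheory GRing.Theory Num.Theory.
Local Open Scope ring_scope.
Local Open Scope classical_set_scope.

(* Private coins: the first component belongs to the coordinator, the second
   gives each server its own string. Strings are uniform and independent. *)
Notation coins s m := (m.-tuple bool * {ffun 'I_s -> m.-tuple bool})%type.

(* The coordinator sees the contents of all channels and its own coins, and
   decides which channel is used next or which answer is reported. A server
   sees only its own channel, its own input and its own coins. Messages are
   sent bit by bit; whether the next bit of a channel is due from the server
   or from the coordinator depends only on the contents of that channel, which
   both ends know, so that no information is conveyed by silence or timing. *)
Record coord_protocol (s : nat) (X : Type) := CoordProtocol {
  cp_coins : nat;
  cp_next : cp_coins.-tuple bool -> {ffun 'I_s -> seq bool} -> bool + 'I_s;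
  cp_server_turn : 'I_s -> seq bool -> bool;
  cp_coord_bit : cp_coins.-tuple bool -> {ffun 'I_s -> seq bool} -> bool;
  cp_server_bit : 'I_s -> X -> cp_coins.-tuple bool -> seq bool -> bool
}.

Section CoordinatorExecution.
Variables (s : nat) (X : Type) (P : coord_protocol s X).
Variables (x : 'I_s -> X) (r : coins s (cp_coins P)).

Definition cp_bit (h : {ffun 'I_s -> seq bool}) (i : 'I_s) : bool :=
  if cp_server_turn P i (h i) then cp_server_bit i (x i) (r.2 i) (h i)
  else cp_coord_bit r.1 h.

Definition cp_extend (h : {ffun 'I_s -> seq bool}) (i : 'I_s) :
    {ffun 'I_s -> seq bool} :=
  [ffun j => if j == i then rcons (h i) (cp_bit h i) else h j].

(* [None] means that no answer is reported within [c] further bits. *)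
Fixpoint cp_run (c : nat) (h : {ffun 'I_s -> seq bool}) : option bool :=
  match cp_next r.1 h with
  | inl ans => Some ans
  | inr i => if c is c'.+1 then cp_run c' (cp_extend h i) else None
  end.

Definition cp_output (c : nat) : option bool := cp_run c [ffun=> [::]].
End CoordinatorExecution.

Inductive bb_turn (s : nat) :=
  | BBTerminate
  | BBCoordinator
  | BBServer of 'I_s.
Arguments BBTerminate {s}.
Arguments BBCoordinator {s}.

(* All parties see the whole board, and its contents alone determine who
   writes the next bit or that the protocol is over. *)
Record bb_protocol (s : nat) (X : Type) := BBProtocol {
  bb_coins : nat;
  bb_next : seq bool -> bb_turn s;
  bb_coord_bit : bb_coins.-tuple bool -> seq bool -> bool;
  bb_server_bit : 'I_s -> X -> bb_coins.-tuple bool -> seq bool -> bool;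
  bb_report : bb_coins.-tuple bool -> seq bool -> bool
}.

Section BlackboardExecution.
Variables (s : nat) (X : Type) (P : bb_protocol s X).
Variables (x : 'I_s -> X) (r : coins s (bb_coins P)).

Fixpoint bb_run (c : nat) (h : seq bool) : option bool :=
  match bb_next P h with
  | BBTerminate => Some (bb_report r.1 h)
  | BBCoordinator =>
      if c is c'.+1 then bb_run c' (rcons h (bb_coord_bit r.1 h)) else None
  | BBServer i =>
      if c is c'.+1 then bb_run c' (rcons h (bb_server_bit i (x i) (r.2 i) h))
      else None
  end.

Definition bb_output (c : nat) : option bool := bb_run c [::].
End BlackboardExecution.

Section RandomizedComplexity.
Variables (R : realType) (s : nat) (X I : Type).
Variables (view : I -> 'I_s -> X) (answer : I -> bool) (q : R).

(* [out x r c] is the answer reported on local inputs [x] and coins [r] if the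
   protocol terminates after at most [c] bits, and [None] otherwise. *)
Definition solves_within (m : nat)
    (out : ('I_s -> X) -> coins s m -> nat -> option bool) (c : nat) : Prop :=
  forall z : I,
    (forall r : coins s m, out (view z) r c <> None) /\
    q <= #|[set r : coins s m | out (view z) r c == Some (answer z)]%SET|%:R
         / #|{: (coins s m)}|%:R.

Definition coord_rcc : \bar R :=
  ereal_inf [set (c%:R)%:E | c in
    [set c : nat | exists P : coord_protocol s X,
                     solves_within (@cp_output s X P) c]].

Definition bb_rcc : \bar R :=
  ereal_inf [set (c%:R)%:E | c in
    [set c : nat | exists P : bb_protocol s X,
                     solves_within (@bb_output s X P) c]].
End RandomizedComplexity.

Record instance (n d s L : nat) := Instance {
  inst_A : 'M[int]_(n, d);
  inst_b : 'cV[int]_n;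
  inst_owner : 'I_n -> 'I_s;
  inst_A_bound : forall i j, `|inst_A i j| <= 2 ^+ L;
  inst_b_bound : forall i, `|inst_b i 0| <= 2 ^+ L
}.

Definition server_view (n d s L : nat) (z : instance n d s L) (i : 'I_s) :
    seq ('rV[int]_d * int) :=
  [seq (row k (inst_A z), inst_b z k 0)
     | k <- enum 'I_n & inst_owner z k == i].

Definition feasible (R : realType) (n d : nat)
    (A : 'M[int]_(n, d)) (b : 'cV[int]_n) : Prop :=
  exists x : 'cV[R]_d, map_mx intr A *m x = map_mx intr b.

Definition feasible_answer (R : realType) (n d s L : nat)
    (z : instance n d s L) : bool :=
  `[< feasible R (inst_A z) (inst_b z) >].

Definition feasibility_coord_rcc (R : realType) (n d s L : nat) (q : R) :
    \bar R :=
  coord_rcc (@server_view n d s L) (@feasible_answer R n d s L) q.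

Definition feasibility_bb_rcc (R : realType) (n d s L : nat) (q : R) :
    \bar R :=
  bb_rcc (@server_view n d s L) (@feasible_answer R n d s L) q.

(* Main.v *)
(* The system is feasible iff [A] and [A | b] have the same rank, and the rank
   of an integer matrix is unchanged modulo every prime that does not divide
   some fixed maximal nonzero minor. Such a minor has at most [O(L)] prime
   divisors when [d] is constant, so one of [2 ^ m = Theta(L)] distinct primes,
   picked uniformly, works with probability at least [q]. By the central
   binomial coefficient, all these primes can be taken below [2 ^ (2 m + 4)].
   The coordinator sends its [m] coins, which name the prime [p], to every
   server; each server answers with a square matrix generating the row space
   mod [p] of its equations, that is, [(d + 1) ^ 2] residues of [O(log L)] bits;
   the coordinator adds these spaces and compares the two ranks. *)

Require Import Defs.
From HB Require Import structures.
From mathcomp Require Import all_boot all_order all_algebra all_fingroup.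
From mathcomp Require Import all_classical all_reals all_analysis.
From mathcomp Require Import zify lra.

Set Implicit Arguments.
Unset Strict Implicit.
Unset Printing Implicit Defensive.

Import Order.TTheory GRing.Theory Num.Theory.

(** * Counting primes *)

(** Vandermonde expands the right side into products ['C(n, i) * 'C(n, n - i)], each at least
    ['C(n, i)], and these sum to [(1 + 1) ^ n]. *)
Lemma central_bin_ge (n : nat) : 2 ^ n <= 'C(n + n, n).
Proof.
rewrite -binomial.Vandermonde (expnDn 1 1) leq_sum // => i _.
by rewrite !exp1n !muln1 leq_pmulr // bin_gt0 leq_subr.
Qed.

Lemma divn_double_le (n e : nat) :
  0 < e -> (n + n) %/ e <= n %/ e + n %/ e + (e <= n + n).
Proof.
move=> e_gt0; have [_|?] := leqP e (n + n); last by rewrite divn_small.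
by rewrite divnD // leq_add2l leq_b1.
Qed.

(** Legendre's formula: each power [p ^ k <= n + n] contributes at most 1 to the exponent, and
    larger powers contribute nothing. *)
Lemma logn_central_bin (p n : nat) :
  prime p -> logn p 'C(n + n, n) <= trunc_log p (n + n).
Proof.
move=> p_pr; have p_gt1 := prime_gt1 p_pr.
have := congr1 (logn p) (bin_fact (leq_addr n n)).
rewrite addnK !lognM ?muln_gt0 ?fact_gt0 ?bin_gt0 ?leq_addr // !logn_fact //.
(* The added terms vanish because [n < p ^ k] for [k > n]; the ranges of the Legendre sums now
   agree. *)
have -> : \sum_(1 <= k < n.+1) n %/ p ^ k =
          \sum_(1 <= k < (n + n).+1) n %/ p ^ k.
  rewrite [RHS](big_cat_nat (n := n.+1)) ?ltnS ?leq_addr //=.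
  rewrite [X in _ + X]big_nat_cond [X in _ + X]big1 ?addn0 // => k.
  rewrite andbT => /andP[nk _]; apply: divn_small.
  exact: leq_trans nk (ltnW (ltn_expl _ p_gt1)).
have : \sum_(1 <= k < (n + n).+1) (n + n) %/ p ^ k <=
  \sum_(1 <= k < (n + n).+1) n %/ p ^ k + \sum_(1 <= k < (n + n).+1) n %/ p ^ k
  + \sum_(1 <= k < (n + n).+1) (p ^ k <= n + n).
  rewrite -!big_split /=; apply: leq_sum => k _; apply: divn_double_le.
  by rewrite expn_gt0 ltnW.
suff : \sum_(1 <= k < (n + n).+1) (p ^ k <= n + n) <= trunc_log p (n + n) by lia.
apply: (@leq_trans (\sum_(1 <= k < (n + n).+1) (k <= trunc_log p (n + n)))).
  apply: leq_sum => k _; have [pk|//] := leqP (p ^ k) (n + n).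
  by rewrite trunc_log_max.
rewrite -big_mkcond /= sum1_count.
rewrite -[X in _ <= X](size_iota 1).
rewrite -size_filter; apply: uniq_leq_size.
  by rewrite filter_uniq // iota_uniq.
move=> k; rewrite mem_filter mem_index_iota mem_iota /=.
by move=> /and3P[kt k1 _]; rewrite k1 ltnS.
Qed.

Definition primes_upto (N : nat) : seq nat := [seq p <- iota 0 N.+1 | prime p].

Lemma mem_primes_upto (N p : nat) :
  (p \in primes_upto N) = prime p && (p <= N).
Proof. by rewrite mem_filter mem_iota. Qed.

Lemma primes_upto_uniq (N : nat) : uniq (primes_upto N).
Proof. by rewrite filter_uniq // iota_uniq. Qed.

(** A Chebyshev-type bound: every prime power in ['C(n + n, n)] is at most [n + n], and so is every
    prime dividing it. *)
Lemma size_primes_upto_lb (n : nat) :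
  0 < n -> 2 ^ n <= (n + n) ^ size (primes_upto (n + n)).
Proof.
move=> n_gt0; apply: leq_trans (central_bin_ge n) _.
have c_gt0 : 0 < 'C(n + n, n) by rewrite bin_gt0 leq_addr.
rewrite (prod_prime_decomp c_gt0) prime_decompE big_map /=.
apply: (@leq_trans (\prod_(p <- primes 'C(n + n, n)) (n + n))).
  rewrite !big_seq; apply: leq_prod => p; rewrite mem_primes => /and3P[p_pr _ _].
  apply: leq_trans (trunc_logP (prime_gt1 p_pr) _); last by rewrite addn_gt0 n_gt0.
  by rewrite leq_exp2l ?prime_gt1 // logn_central_bin.
rewrite big_const_seq count_predT iter_muln_1 leq_pexp2l ?addn_gt0 ?n_gt0 //.
apply: uniq_leq_size => [|p]; first exact: primes_uniq.
move=> pC; have p_pr : prime p by move: pC; rewrite mem_primes => /andP[].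
rewrite mem_primes_upto p_pr /=; move: pC; rewrite -logn_gt0 => lp.
have := leq_trans lp (logn_central_bin n p_pr).
by rewrite trunc_log_gt0 => /andP[_]; rewrite prednK // prime_gt0.
Qed.

Lemma size_primes_ub (n : nat) : 0 < n -> 2 ^ size (primes n) <= n.
Proof.
move=> n_gt0; rewrite [X in _ <= X](prod_prime_decomp n_gt0).
rewrite prime_decompE big_map /=.
rewrite -iter_muln_1 -[size _]count_predT -big_const_seq !big_seq.
apply: leq_prod => p p_n; have p_gt1 : 1 < p.
  by move: p_n; rewrite mem_primes => /andP[/prime_gt1].
move: p_n; rewrite -logn_gt0 => lp; apply: leq_trans (p_gt1) _.
by rewrite -{1}(expn1 p) leq_exp2l.
Qed.

Lemma exists_primes (m : nat) :
  exists P : m.-tuple bool -> nat,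
    injective P /\ forall t, prime (P t) /\ P t <= 2 ^ (m + m + 4).
Proof.
(* The exponent ensures [2 ^ m * (2 m + 4) <= N]. With [k] primes up to [N + N],
   [2 ^ N <= (N + N) ^ k = 2 ^ ((2 m + 4) k)], hence [2 ^ m <= k]. *)
pose N := 2 ^ (m + m + 3).
have NN : N + N = 2 ^ (m + m + 4) by rewrite /N !addnS !expnS; lia.
have : 2 ^ m <= size (primes_upto (N + N)).
  have := @size_primes_upto_lb N; rewrite expn_gt0 => /(_ isT).
  rewrite {1}NN -expnM leq_exp2l // => h.
  have : 2 ^ m * (m + m + 4) <= N.
    rewrite /N -(addnA m m 3) expnD leq_mul // expnD.
    have := ltn_expl m (isT : 1 < 2); lia.
  by move: (size _) h => z; nia.
move=> le_sz.
pose P (t : m.-tuple bool) := nth 0 (primes_upto (N + N)) (enum_rank t).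
have lt (t : m.-tuple bool) : enum_rank t < size (primes_upto (N + N)).
  apply: leq_trans _ le_sz.
  have <- : #|{: m.-tuple bool}| = 2 ^ m by rewrite card_tuple card_bool.
  exact: ltn_ord.
exists P; split => [t u /eqP|t].
  rewrite /P nth_uniq ?primes_upto_uniq //.
  by move=> /eqP/val_inj/enum_rank_inj.
by apply/andP; rewrite -NN -mem_primes_upto mem_nth.
Qed.

(** * One-round protocols *)

Section OneRound.
Variables (s : nat) (X : Type) (m k : nat).
Variable msg : X -> m.-tuple bool -> k.-tuple bool.
Variable ans : m.-tuple bool -> {ffun 'I_s -> k.-tuple bool} -> bool.

Definition slice (a l : nat) (h : seq bool) : l.-tuple bool :=
  [tuple nth false h (a + j) | j < l].

Definition one_round_answer (x : 'I_s -> X) (t : m.-tuple bool) : bool :=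
  ans t [ffun i => msg (x i) t].

Definition open_channel (h : {ffun 'I_s -> seq bool}) : option 'I_s :=
  [pick i | (size (h i) < m + k)%N].

Lemma open_channelP (h : {ffun 'I_s -> seq bool}) :
  if open_channel h is Some i then is_true (size (h i) < m + k)%N
  else forall i, (m + k <= size (h i))%N.
Proof.
by rewrite /open_channel; case: pickP => // hN i; rewrite leqNgt hN.
Qed.

(** Each channel carries the [m] coordinator coins, then the [k] reply bits. The coordinator's bit
    function is not told the channel, so it recomputes the [open_channel] choice. *)
Definition coord_one_round : coord_protocol s X :=
  @CoordProtocol s X m
    (fun t h => if open_channel h is Some i then inr i
                else inl (ans t [ffun i => slice m k (h i)]))
    (fun _ g => (m <= size g)%N)
    (fun t h => if open_channel h is Some i then nth false t (size (h i))
                else false)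
    (fun _ y _ g => nth false (msg y (slice 0 m g)) (size g - m)).

(** After the coins the board consists of [s] blocks of [k] bits; the block index names the writer,
    and [insub] fails exactly when it reaches [s]. *)
Definition bb_one_round : bb_protocol s X :=
  @BBProtocol s X m
    (fun h => if (size h < m)%N then BBCoordinator
              else if insub ((size h - m) %/ k)%N is Some i then BBServer i
              else BBTerminate)
    (fun t h => nth false t (size h))
    (fun _ y _ h => nth false (msg y (slice 0 m h)) ((size h - m) %% k)%N)
    (fun t h => ans t [ffun i : 'I_s => slice (m + i * k) k h]).

Variables (x : 'I_s -> X) (r : coins s m).

Definition channel_bit (i : 'I_s) (n : nat) : bool :=
  if (n < m)%N then nth false r.1 n else nth false (msg (x i) r.1) (n - m).

Lemma slice0_mkseq (f : nat -> bool) (l : nat) (t : m.-tuple bool) :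
  (m <= l)%N -> (forall n, (n < m)%N -> f n = nth false t n) ->
  slice 0 m (mkseq f l) = t.
Proof.
move=> ml ft; apply: eq_from_tnth => j.
rewrite tnth_mktuple add0n nth_mkseq ?(leq_trans (ltn_ord j)) //.
by rewrite ft // -tnth_nth.
Qed.

Lemma slice_channel (i : 'I_s) :
  slice m k (mkseq (channel_bit i) (m + k)) = msg (x i) r.1.
Proof.
apply: eq_from_tnth => j; rewrite tnth_mktuple nth_mkseq ?ltn_add2l //.
by rewrite /channel_bit ltnNge leq_addr /= addKn -tnth_nth.
Qed.

(** Invariant for the induction on the budget: every channel is a prefix of its final transcript
    [channel_bit], and [c] covers all missing bits. *)
Lemma coord_one_round_run (c : nat) (h : {ffun 'I_s -> seq bool}) :
  (forall i, h i = mkseq (channel_bit i) (size (h i))) ->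
  (forall i, size (h i) <= m + k)%N ->
  (\sum_i (m + k - size (h i)) <= c)%N ->
  @cp_run s X coord_one_round x r c h = Some (one_round_answer x r.1).
Proof.
elim: c h => [|c IH] h hE hle hc.
all: rewrite /=; have := open_channelP h; case E: (open_channel h) => [i|] hi.
2, 4: congr (Some (ans _ _)); apply/ffunP => i; rewrite !ffunE hE.
2, 3: suff -> : size (h i) = (m + k)%N by exact: slice_channel.
2, 3: by apply/eqP; rewrite eqn_leq hle hi.
  (* An open channel still lacks a bit, so the budget cannot be 0. *)
  by move: hc; rewrite (bigD1 i) //=; lia.
have bitE : @cp_bit s X coord_one_round x r h i = channel_bit i (size (h i)).
  rewrite /cp_bit /channel_bit /=; case: leqP => hm; last by rewrite E.
  rewrite [in slice _ _ _]hE (slice0_mkseq (t := r.1)) // => n nm.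
  by rewrite /channel_bit nm.
apply: IH => [j|j|].
- rewrite /cp_extend ffunE; case: eqP => [->|_] //.
  by rewrite size_rcons mkseqS -hE bitE.
- by rewrite /cp_extend ffunE; case: eqP => // _; rewrite size_rcons.
- move: hc; rewrite (bigD1 i) //= [X in (X <= c)%N](bigD1 i) //=.
  rewrite {1}/cp_extend ffunE eqxx size_rcons.
  under [X in _ -> (_ + X <= c)%N]eq_bigr => j ji
    do rewrite /cp_extend ffunE (negbTE ji).
  lia.
Qed.

Lemma coord_one_round_output :
  @cp_output s X coord_one_round x r (s * (m + k)) =
  Some (one_round_answer x r.1).
Proof.
apply: coord_one_round_run => [i|i|]; rewrite ?ffunE //.
under eq_bigr => i _ do rewrite ffunE subn0.
by rewrite sum_nat_const card_ord.
Qed.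

Definition board_bit (n : nat) : bool :=
  if (n < m)%N then nth false r.1 n
  else if insub ((n - m) %/ k)%N is Some i
  then nth false (msg (x i) r.1) ((n - m) %% k)%N else false.

Hypothesis k_gt0 : (0 < k)%N.

Lemma slice_board (i : 'I_s) :
  slice (m + i * k) k (mkseq board_bit (m + s * k)) = msg (x i) r.1.
Proof.
apply: eq_from_tnth => j; have := ltn_ord i; have := ltn_ord j => jk is_.
rewrite tnth_mktuple nth_mkseq; last by nia.
rewrite /board_bit ltnNge -addnA leq_addr /= addKn.
have -> : ((i * k + j) %/ k = i)%N by rewrite divnMDl // divn_small // addn0.
by rewrite valK modnMDl modn_small // -tnth_nth.
Qed.

Lemma bb_one_round_run (c l : nat) :
  (l <= m + s * k)%N -> (m + s * k - l <= c)%N ->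
  @bb_run s X bb_one_round x r c (mkseq board_bit l) =
  Some (one_round_answer x r.1).
Proof.
elim: c l => [|c IH] l lle lc /=; rewrite size_mkseq.
all: case: ltnP => lm; [|case: insubP => [i|]].
- by lia.
- by rewrite ltn_divLR //; lia.
- rewrite -leqNgt leq_divRL // => sl; have -> : l = (m + s * k)%N by lia.
  by congr (Some (ans _ _)); apply/ffunP => i; rewrite !ffunE slice_board.
- have -> : nth false r.1 l = board_bit l by rewrite /board_bit lm.
  by rewrite -mkseqS; apply: IH; lia.
- move=> li iE.
  have -> : nth false (msg (x i) (slice 0 m (mkseq board_bit l)))
                  ((l - m) %% k) = board_bit l.
    rewrite (slice0_mkseq (t := r.1)) // => [|n nm]; last by rewrite /board_bit nm.
    rewrite /board_bit ltnNge lm /=; case: insubP => [j _ jE|]; last by rewrite li.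
    by congr (nth _ (msg (x _) _) _); apply: val_inj; rewrite iE jE.
  by rewrite -mkseqS; move: li; rewrite ltn_divLR // => li; apply: IH; lia.
- rewrite -leqNgt leq_divRL // => sl; have -> : l = (m + s * k)%N by lia.
  by congr (Some (ans _ _)); apply/ffunP => i; rewrite !ffunE slice_board.
Qed.

(** The board needs only [m + s * k] bits; the looser budget, valid as [0 < s], is the one of the
    coordinator model. *)
Lemma bb_one_round_output :
  (0 < s)%N ->
  @bb_output s X bb_one_round x r (s * (m + k)) =
  Some (one_round_answer x r.1).
Proof. move=> ?; apply: (@bb_one_round_run _ 0) => //; nia. Qed.
End OneRound.

(** * Ranks of integer matrices modulo primes *)

Local Open Scope ring_scope.

Lemma mxrank_minor (F : fieldType) (m n : nat) (A : 'M[F]_(m, n)) :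
  exists (f : 'I_(\rank A) -> 'I_m) (g : 'I_(\rank A) -> 'I_n),
    \det (mxsub f g A) != 0.
Proof.
have full : row_full (rowsub (maxrankfun A) A)^T.
  by rewrite /row_full mxrank_tr; exact: maxrowsub_free.
exists (maxrankfun A), (fullrankfun full).
have := fullrowsub_unit full; rewrite unitmxE unitfE -det_tr.
by congr (\det _ != 0); apply/matrixP => i j; rewrite !mxE.
Qed.

Lemma minor_le_mxrank (F : fieldType) (m n r : nat) (A : 'M[F]_(m, n))
    (f : 'I_r -> 'I_m) (g : 'I_r -> 'I_n) :
  \det (mxsub f g A) != 0 -> (r <= \rank A)%N.
Proof.
rewrite -unitfE -unitmxE => /mxrank_unit rkB.
rewrite -[X in (X <= _)%N]rkB -[A in mxsub f g A]mulmx1 mxsub_mul.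
apply: leq_trans (mxrankM_maxl _ _) _.
by rewrite rowsubE mxrankM_maxr.
Qed.

(** A nonzero minor of maximal size over [F] is the image of an integer, which stays nonzero in
    [K]. *)
Lemma mxrank_intr_le (F K : fieldType) (m n : nat) (A : 'M[int]_(m, n)) :
  (forall a : int, a%:~R != 0 :> F -> a%:~R != 0 :> K) ->
  (\rank (map_mx intr A : 'M[F]_(m, n)) <=
   \rank (map_mx intr A : 'M[K]_(m, n)))%N.
Proof.
move=> FK; have [f [g]] := mxrank_minor (map_mx intr A : 'M[F]_(m, n)).
rewrite -map_mxsub det_map_mx => /FK nz.
by apply: (@minor_le_mxrank _ _ _ _ _ f g); rewrite -map_mxsub det_map_mx.
Qed.

Lemma norm_det_le (r : nat) (M : int) (A : 'M[int]_r) :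
  (forall i j, `|A i j| <= M) -> `|\det A| <= M ^+ r *+ r`!.
Proof.
move=> AM; apply: le_trans (ler_norm_sum _ _ _) _.
rewrite -card_Sn -sumr_const; apply: ler_sum => /= u _.
rewrite normrM normrX normrN1 expr1n mul1r normr_prod.
rewrite -[X in _ <= M ^+ X]card_ord -prodr_const.
by apply: ler_prod => i _; rewrite normr_ge0 AM.
Qed.

Lemma mxrank_Fp_eq (K : numFieldType) (m n L : nat) (A : 'M[int]_(m, n)) :
  (forall i j, `|A i j| <= 2 ^+ L) ->
  exists D : nat, [/\ (0 < D)%N, (D <= 2 ^ (n`! + L * n))%N &
    forall p, prime p -> ~~ (p %| D)%N ->
      \rank (map_mx intr A : 'M['F_p]_(m, n)) =
      \rank (map_mx intr A : 'M[K]_(m, n))].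
Proof.
move=> AL; have [f [g]] := mxrank_minor (map_mx intr A : 'M[K]_(m, n)).
set r := \rank _ in f g *; rewrite -map_mxsub det_map_mx intr_eq0 => nz.
(* [D] is a maximal minor that is nonzero over [K]; it survives modulo every prime not dividing
   it. *)
exists `|\det (mxsub f g A)|%N; split=> [||p p_pr pD]; first by rewrite absz_gt0.
  have rn : (r <= n)%N by exact: rank_leq_col.
  rewrite -lez_nat abszE.
  apply: le_trans (@norm_det_le r (2 ^+ L) _ _) _ => [i j|]; first by rewrite mxE.
  rewrite -exprM -mulr_natr -natrX -natrM natz lez_nat addnC expnD leq_mul //.
    by rewrite leq_exp2l // leq_mul2l rn orbT.
  (* The crude [n! <= 2 ^ n!] suffices, since [n] will be [d] or [d + 1], a constant. *)
  exact: leq_trans (leq_fact rn) (ltnW (ltn_expl _ _)).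
have pc := pchar_Fp p_pr.
apply/eqP; rewrite eqn_leq; apply/andP; split.
  apply: mxrank_intr_le => a; rewrite intr_eq0; apply: contraNneq => ->.
  by rewrite mulr0z.
apply: (@minor_le_mxrank _ _ _ _ _ f g).
by rewrite -map_mxsub det_map_mx /= -(dvdz_pcharf pc).
Qed.

(** Solvability means that [b] lies in the column space of [A]; transposing turns this into an
    inclusion of row spaces. *)
Lemma solvable_mxrank (F : fieldType) (m n : nat) (A : 'M[F]_(m, n))
    (b : 'cV[F]_m) :
  (exists x : 'cV[F]_n, A *m x = b) <-> \rank (row_mx A b) = \rank A.
Proof.
rewrite -mxrank_tr tr_row_mx -[in X in _ <-> _ = X]mxrank_tr.
have -> : \rank (col_mx A^T b^T) = \rank (A^T + b^T)%MS by rewrite addsmxE.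
have := mxrank_leqif_eq (addsmxSl A^T b^T) => -[_ E].
split=> [[x Ax]|/esym/eqP].
  apply/esym/eqP; rewrite E addsmxSl /= addsmx_sub submx_refl /=.
  by apply/submxP; exists x^T; rewrite -trmx_mul Ax.
rewrite E => /andP[_]; rewrite addsmx_sub => /andP[_ /submxP[y yb]].
by exists y^T; apply: trmx_inj; rewrite trmx_mul trmxK.
Qed.

Lemma sum_genmx_row (F : fieldType) (m n : nat) (A : 'M[F]_(m, n)) :
  (\sum_i <<row i A>> :=: A)%MS.
Proof.
apply/eqmxP/andP; split.
  by apply/sumsmx_subP => i _; rewrite genmxE row_sub.
by apply/row_subP => i; apply: (sumsmx_sup i) => //; rewrite genmxE.
Qed.

(** Lets residue matrices be sent as bit strings by a counting argument alone; [t0] decodes strings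
    that encode nothing. *)
Lemma finType_encoding (T U : finType) (t0 : T) :
  (#|T| <= #|U|)%N -> {c : (T -> U) * (U -> T) | cancel c.1 c.2}.
Proof.
move=> le_TU; exists (fun t => enum_val (widen_ord le_TU (enum_rank t)),
  fun u => if insub (val (enum_rank u)) is Some i then @enum_val T T i else t0).
by move=> t /=; rewrite enum_valK /= valK enum_rankK.
Qed.

(** * Testing feasibility modulo a random prime *)

(** A square generator of the row space of the augmented equations, so its size does not grow with
    their number. *)
Definition view_space (F : fieldType) (d : nat)
    (v : seq ('rV[int]_d * int)) : 'M[F]_(d + 1) :=
  (\sum_(e <- v) <<map_mx intr (row_mx e.1 e.2%:M) : 'rV[F]_(d + 1)>>)%MS.

Lemma sum_view_space (F : fieldType) (n d s L : nat) (z : instance n d s L) :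
  (\sum_i view_space F (server_view z i) :=:
   map_mx intr (row_mx (inst_A z) (inst_b z)))%MS.
Proof.
set M : 'M[F]_(n, d + 1) := map_mx _ _.
suff -> : (\sum_i view_space F (server_view z i) = \sum_k <<row k M>>)%MS.
  exact: sum_genmx_row.
(* Each row has exactly one owner, so the rows can be grouped by server. *)
rewrite [RHS](partition_big (inst_owner z) xpredT) //=; apply: eq_bigr => i _.
rewrite /view_space /server_view big_map big_filter big_enum_cond /=.
apply: eq_bigr => k _; rewrite -map_row row_row_mx /=.
congr (genmx (map_mx intr (row_mx _ _))).
by apply/matrixP => u v; rewrite !ord1 !mxE eqxx mulr1n.
Qed.

(** Dropping the last columns is right multiplication by a fixed matrix, so the row space of
    [[A | b]] alone determines the rank of [A]. *)
Lemma mxrank_lsubmx_eqmx (F : fieldType) (m1 m2 n1 n2 : nat)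
    (A : 'M[F]_(m1, n1 + n2)) (B : 'M[F]_(m2, n1 + n2)) :
  (A :=: B)%MS -> \rank (lsubmx A) = \rank (lsubmx B).
Proof.
have lsubE m (M : 'M[F]_(m, n1 + n2)) : lsubmx M = M *m col_mx 1%:M 0.
  by rewrite -[M in RHS]hsubmxK mul_row_col mulmx1 mulmx0 addr0.
by move=> AB; rewrite !lsubE (eqmxMr _ AB).
Qed.

Definition rank_test (F : fieldType) (d : nat) (V : 'M[F]_(d + 1)) : bool :=
  \rank V == \rank (lsubmx V).

Lemma rank_test_sum_view (F : fieldType) (n d s L : nat)
    (z : instance n d s L) :
  rank_test (\sum_i view_space F (server_view z i))%MS =
  (\rank (map_mx intr (row_mx (inst_A z) (inst_b z)) : 'M[F]_(n, d + 1)) ==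
   \rank (map_mx intr (inst_A z) : 'M[F]_(n, d))).
Proof.
have VE := sum_view_space F z.
by rewrite /rank_test (mxrank_lsubmx_eqmx VE) VE map_row_mx row_mxKl.
Qed.

(** Base-2 logarithm of the bound on the product of two minors, one of [[A | b]] and one of [A]. *)
Definition bad_primes_bound (d L : nat) : nat :=
  ((d + 1)`! + L * (d + 1) + (d`! + L * d))%N.

Lemma feasible_answer_mod_p (R : realType) (n d s L : nat)
    (z : instance n d s L) :
  exists D : nat, [/\ (0 < D)%N, (D <= 2 ^ bad_primes_bound d L)%N &
    forall p, prime p -> ~~ (p %| D)%N ->
      rank_test (\sum_i view_space 'F_p (server_view z i))%MS =
      feasible_answer R z].
Proof.
have [i j|D1 [D1_gt0 D1_le rk1]] :=
  @mxrank_Fp_eq R n (d + 1) L (row_mx (inst_A z) (inst_b z)).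
  rewrite mxE; case: splitP => k _; first exact: inst_A_bound.
  rewrite ord1; exact: inst_b_bound.
have [D2 [D2_gt0 D2_le rk2]] := @mxrank_Fp_eq R n d L _ (inst_A_bound z).
exists (D1 * D2)%N; split=> [||p p_pr].
- by rewrite muln_gt0 D1_gt0.
- by rewrite expnD leq_mul.
rewrite Euclid_dvdM // negb_or => /andP[pD1 pD2].
rewrite rank_test_sum_view rk1 // rk2 // map_row_mx.
by apply/eqP/asboolP => /solvable_mxrank.
Qed.

Lemma feasibility_one_round (R : realType) (n d s L m : nat) :
  exists (msg : seq ('rV[int]_d * int) -> m.-tuple bool ->
                ((m + m + 4) * ((d + 1) * (d + 1))).-tuple bool)
         (ans : m.-tuple bool -> {ffun 'I_s ->
                ((m + m + 4) * ((d + 1) * (d + 1))).-tuple bool} -> bool),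
  forall z : instance n d s L,
    (#|[set t | one_round_answer msg ans (server_view z) t
                != feasible_answer R z]%SET| <= bad_primes_bound d L)%N.
Proof.
have [P [P_inj P_pr]] := exists_primes m.
(* There are [p ^ ((d + 1) ^ 2)] matrices, and [p <= 2 ^ (2 m + 4)]. *)
have cardM (t : m.-tuple bool) : (#|{: 'M['F_(P t)]_(d + 1)}| <=
    #|{: ((m + m + 4) * ((d + 1) * (d + 1))).-tuple bool}|)%N.
  have [p_pr p_le] := P_pr t.
  rewrite card_mx card_Fp // card_tuple card_bool.
  by rewrite [(2 ^ _)%N]expnM leq_exp2r // addn1.
pose code t := finType_encoding 0 (cardM t).
exists (fun v t => (sval (code t)).1 (view_space _ v)).
exists (fun t g => rank_test (\sum_i (sval (code t)).2 (g i))%MS) => z.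
have [D [D_gt0 D_le test]] := feasible_answer_mod_p R z.
apply: (@leq_trans (size (primes D))); last first.
  by rewrite -(@leq_exp2l 2) // (leq_trans (size_primes_ub D_gt0)).
(* [P] maps the bad coin strings injectively to prime divisors of [D]. *)
rewrite cardE -(size_map P); apply: uniq_leq_size.
  by rewrite map_inj_uniq // enum_uniq.
move=> p /mapP[t]; rewrite mem_enum inE /one_round_answer => bad ->.
have [p_pr _] := P_pr t; rewrite mem_primes p_pr D_gt0 /=.
apply: contraNT bad => pD; rewrite -(test _ p_pr pD).
under eq_bigr => i _ do rewrite ffunE (svalP (code t)).
by [].
Qed.

(** * Success probability and total cost *)

Lemma first_coins_solve (R : realType) (s m c : nat) (X I : Type)
    (view : I -> 'I_s -> X) (answer : I -> bool) (q : R)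
    (out : ('I_s -> X) -> coins s m -> nat -> option bool)
    (f : ('I_s -> X) -> m.-tuple bool -> bool) :
  (forall x r, out x r c = Some (f x r.1)) ->
  (forall z, #|[set t | f (view z) t != answer z]%SET|%:R <= (1 - q) * 2 ^+ m) ->
  solves_within view answer q out c.
Proof.
move=> outE bad z; split=> [r|]; first by rewrite outE.
set B := [set t | f (view z) t != answer z]%SET.
(* Success depends only on the coordinator's coins, so it is a product event and the servers' factor
   cancels. *)
have -> : [set r | out (view z) r c == Some (answer z)]%SET =
          finset.setX (~: B) [set: {ffun 'I_s -> m.-tuple bool}]%SET.
  by apply/setP => r; rewrite !inE outE andbT negbK.
rewrite cardsX cardsT card_prod !natrM -mulf_div divff ?mulr1; last first.
  rewrite pnatr_eq0 -lt0n; apply/card_gt0P; exists [ffun=> [tuple of nseq m false]].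
  by [].
have cardT : #|{: m.-tuple bool}| = (2 ^ m)%N by rewrite card_tuple card_bool.
rewrite ler_pdivlMr ?ltr0n ?cardT ?expn_gt0 //.
have := cardsC B; rewrite cardT.
move=> /(congr1 (fun k => k%:R : R)); rewrite natrD natrX => E.
by have := bad z; rewrite -/B; lra.
Qed.

Theorem theorem1p3 (R : realType) (d : nat) (q : R) (hq : 0 < q < 1) :
  exists C : R, 0 < C /\
    forall n s L : nat, (2 <= s)%N -> (2 <= L)%N ->
      (feasibility_coord_rcc n d s L q <= (C * s%:R * ln (L%:R : R))%:E)%E /\
      (feasibility_bb_rcc n d s L q <= (C * s%:R * ln (L%:R : R))%:E)%E.
Proof.
have /andP[_ q_lt1] := hq.
(* The bound is affine in [L], so its value at 1 times [L] dominates it for [L >= 1]. *)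
pose c := bad_primes_bound d 1.
(* [2 ^ a >= c / (1 - q)]; with [2 ^ l >= L] below, at most a fraction [1 - q] of the [2 ^ m] primes
   is bad. *)
pose a := up_log 2 (Num.bound (c%:R / (1 - q))).
(* As [l >= 1], [m <= (a + 1) l] and [2 m + 4 <= (2 a + 6) l], so [W * l] bounds the cost per
   server. *)
pose W := ((a + 1) + (2 * a + 6) * ((d + 1) * (d + 1)))%N.
have ln2_gt0 : 0 < ln 2 :> R by rewrite ln_gt0 // ltr1n.
exists (W%:R * (2 / ln 2)); split.
  by rewrite mulr_gt0 ?divr_gt0 // ltr0n /W addn1.
move=> n s L s_ge2 L_ge2.
pose l := up_log 2 L; pose m := (a + l)%N.
have l_gt0 : (0 < l)%N by rewrite up_log_gt0.
have lnL_ge : ln 2 <= ln L%:R :> R by rewrite ler_ln ?posrE ?ler_nat ?ltr0n //; lia.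
(* Minimality of [l] gives [2 ^ (l - 1) <= L], so [l <= log2 L + 1 <= 2 log2 L] as [L >= 2]. *)
have l_le : l%:R <= 2 / ln 2 * ln L%:R :> R.
  have : ln (2 ^+ l.-1) <= ln L%:R :> R.
    rewrite ler_ln ?posrE ?exprn_gt0 ?ltr0n //; last by lia.
    by rewrite -natrX ler_nat ltnW // up_log_gtn.
  rewrite lnXn // => lnl; rewrite mulrAC ler_pdivlMr //.
  have -> : l%:R = l.-1%:R + 1 :> R by rewrite natr1 prednK.
  by move: lnl; rewrite -(mulr_natl (ln 2)); lra.
have bad_le : (bad_primes_bound d L)%:R <= (1 - q) * 2 ^+ m :> R.
  have bL : (bad_primes_bound d L <= c * L)%N by rewrite /c /bad_primes_bound; nia.
  apply: (@le_trans _ _ (c%:R * L%:R)); first by rewrite -natrM ler_nat.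
  rewrite exprD mulrA ler_pM //.
    rewrite mulrC -ler_pdivrMr ?subr_gt0 //.
    apply: (@le_trans _ _ (Num.bound (c%:R / (1 - q)) : nat)%:R).
      by rewrite ltW // archi_boundP // divr_ge0 // subr_ge0 ltW.
    by rewrite -natrX ler_nat up_logP.
  by rewrite -natrX ler_nat up_logP.
have cost_le : (s * (m + (m + m + 4) * ((d + 1) * (d + 1))))%:R <=
    W%:R * (2 / ln 2) * s%:R * ln L%:R :> R.
  rewrite [leRHS](_ : _ = s%:R * (W%:R * (2 / ln 2 * ln L%:R))); last first.
    by rewrite mulrAC [RHS]mulrC !mulrA.
  apply: (@le_trans _ _ (s%:R * (W%:R * l%:R))); last first.
    by rewrite ler_wpM2l ?ler0n // ler_wpM2l ?ler0n.
  have m_le : (m <= (a + 1) * l)%N by rewrite /m; nia.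
  have b_le : (m + m + 4 <= (2 * a + 6) * l)%N by rewrite /m; nia.
  rewrite -!natrM ler_nat leq_mul // [leqRHS]mulnDl leq_add //.
  by rewrite mulnAC leq_mul.
have [msg [ans bad]] := feasibility_one_round R n d s L m.
have {}bad (z : instance n d s L) :
    #|[set t | one_round_answer msg ans (server_view z) t
               != feasible_answer R z]%SET|%:R <= (1 - q) * 2 ^+ m.
  by apply: le_trans bad_le; rewrite ler_nat bad.
split; apply: le_trans (_ : (_%:R)%:E <= _)%E; try by rewrite lee_fin; exact: cost_le.
  apply: ereal_inf_lbound; eexists; last reflexivity.
  exists (coord_one_round msg ans).
  by apply: first_coins_solve bad => x r; exact: coord_one_round_output.
apply: ereal_inf_lbound; eexists; last reflexivity.
exists (bb_one_round msg ans).
apply: first_coins_solve bad => x r; apply: bb_one_round_output.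
  by rewrite !muln_gt0 !addn_gt0 !orbT.
by apply: ltn_trans s_ge2.
Qed.
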